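(* Let $(A,\succ,\prec,\Phi=\{\partial_k\}_{k=1}^m)$ be a differential dendriform algebra and $(A,\cdot,\Phi)$ be the associated differential algebra, $a\cdot b=a\succ b+a\prec b$. Let $\{e_1,\dots,e_n\}$ be a basis of $A$ and $\{e_1^*,\dots,e_n^*\}$ be the dual basis. Let $(\theta_1,\dots,\theta_m)\in\mathbb F^m$ be given. Then $s=\sum_{i=1}^n(e_i\otimes e_i^*-e_i^*\otimes e_i)$ is an antisymmetric solution of the $(\{-\partial_k+\theta_k\mathrm{id}_A\}_{k=1}^m+\Phi^* )$-admissible AYBE in the $(\{-\partial_k+\theta_k\mathrm{id}_A\}_{k=1}^m+\Phi^* )$-admissible differential algebra $(A\ltimes_{R_\prec^*,L_\succ^*}A^*,\cdot,\Phi+\{-\partial_k^*+\theta_k\mathrm{id}_{A^*}\}_{k=1}^m)$. Therefore there is a differential ASI bialgebra $$(A\ltimes_{R_\prec^*,L_\succ^*}A^*,\cdot,\Delta,\Phi+\{-\partial_k^*+\theta_k\mathrm{id}_{A^*}\}_{k=1}^m,\{-\partial_k+\theta_k\mathrm{id}_A\}_{k=1}^m+\Phi^* ),$$ where, writing $\hat A=A\ltimes_{R_\prec^*,L_\succ^*}A^*$, the linear map $\Delta$ is defined by $\Delta(x)=(\mathrm{id}\otimes L_{\hat A}(x)-R_{\hat A}(x)\otimes\mathrm{id})(s)$ for all $x\in\hat A$.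
   Context: All vector spaces and algebras are finite-dimensional over a field $\mathbb F$ of characteristic $0$; ''algebra'' means associative algebra, not necessarily unital. Transposes are denoted by $*$; for $\mu\colon A\to\mathrm{End}(V)$, $\mu^*(a)=\mu(a)^*$ (no sign); $\Phi^*=\{\partial_k^*\}$. $L_A(a)b=a\cdot b=R_A(b)a$. $\sigma$ is the flip; $s$ is antisymmetric if $s=-\sigma(s)$. For families of maps on $V_1$ and $V_2$, $\{\alpha_k\}+\{\beta_k\}$ is the family $v_1+v_2\mapsto\alpha_k(v_1)+\beta_k(v_2)$ on $V_1\oplus V_2$. Dendriform algebra $(A,\succ,\prec)$: $(a\prec b)\prec c=a\prec(b\prec c+b\succ c)$, $(a\succ b)\prec c=a\succ(b\prec c)$, $(a\prec b+a\succ b)\succ c=a\succ(b\succ c)$. Differential dendriform algebra $(A,\succ,\prec,\Phi=\{\partial_k\})$: additionally the $\partial_k$ are pairwise commuting linear maps that are derivations for both $\succ$ and $\prec$. Then $(A,\cdot,\Phi)$ with $a\cdot b=a\succ b+a\prec b$ is a differential algebra (algebra with pairwise commuting derivations), called the associated one. $L_\succ(a)b=a\succ b$, $R_\prec(a)b=b\prec a$. $A\ltimes_{R_\prec^*,L_\succ^*}A^*$ is $A\oplus A^*$ with product $(a+a^* )\cdot(b+b^* )=a\cdot b+R_\prec^*(a)b^*+L_\succ^*(b)a^*$. A differential algebra $(A,\cdot,\{\partial_k\})$ is $\Psi=\{\eth_k\}$-admissible ($\eth_k$ pairwise commuting linear maps on $A$) if $\eth_k(a)\cdot b=a\cdot\partial_k(b)+\eth_k(a\cdot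 b)$ and $a\cdot\eth_k(b)=\partial_k(a)\cdot b+\eth_k(a\cdot b)$. An element $s=\sum_ia_i\otimes b_i\in A\otimes A$ is a solution of the $\Psi$-admissible AYBE in $(A,\cdot,\{\partial_k\})$ if $s_{12}s_{13}+s_{13}s_{23}-s_{23}s_{12}=0$, where $s_{12}s_{13}=\sum a_i\cdot a_j\otimes b_i\otimes b_j$, $s_{13}s_{23}=\sum a_i\otimes a_j\otimes b_i\cdot b_j$, $s_{23}s_{12}=\sum a_j\otimes a_i\cdot b_j\otimes b_i$, and $(\partial_k\otimes\mathrm{id}-\mathrm{id}\otimes\eth_k)(s)=0=(\eth_k\otimes\mathrm{id}-\mathrm{id}\otimes\partial_k)(s)$ for all $k$. ASI bialgebra $(A,\cdot,\Delta)$: $(A,\cdot)$ algebra, $(A,\Delta)$ coassociative coalgebra (counit not required), $\Delta(a\cdot b)=(R_A(b)\otimes\mathrm{id})\Delta(a)+(\mathrm{id}\otimes L_A(a))\Delta(b)$ and $(L_A(a)\otimes\mathrm{id}-\mathrm{id}\otimes R_A(a))\Delta(b)=\sigma((\mathrm{id}\otimes R_A(b)-L_A(b)\otimes\mathrm{id})\Delta(a))$. Differential ASI bialgebra $(A,\cdot,\Delta,\Phi=\{\partial_k\},\Psi=\{\eth_k\})$: $(A,\cdot,\Delta)$ is an ASI bialgebra; $(A,\cdot,\Phi)$ is a $\Psi$-admissible differential algebra; the $\eth_k$ are commuting with $\Delta\eth_k=(\eth_k\otimes\mathrm{id}+\mathrm{id}\otimes\eth_k)\Delta$; and $(\partial_k\otimes\mathrm{id})\Delta=(\mathrm{id}\otimes\eth_k)\Delta+\Delta\partial_k$,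 $(\mathrm{id}\otimes\partial_k)\Delta=(\eth_k\otimes\mathrm{id})\Delta+\Delta\partial_k$. *)

(* Defs.v *)
From HB Require Import structures.
From mathcomp Require Import all_boot all_algebra.

Set Implicit Arguments.
Unset Strict Implicit.
Unset Printing Implicit Defensive.

Import GRing.Theory.
Local Open Scope ring_scope.

Reserved Notation "v ⊗ w" (at level 40, left associativity).

Section Tensor.
Variable F : fieldType.
Implicit Types U V W X : vectType F.

(* MathComp has no tensor product of vector spaces. V ⊗ W is modelled by the   *)
(* matrices of coordinates over the bases [vbasis {:V}] and [vbasis {:W}]; the *)
(* lemmas below give the universal property, so this choice is immaterial.     *)
Definition tensor V W : vectType F := 'M[F]_(\dim {:V}, \dim {:W}).

Definition tens V W (v : V) (w : W) : tensor V W :=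
  \matrix_(i, j) (coord (vbasis {:V}) i v * coord (vbasis {:W}) j w).
Local Notation "v ⊗ w" := (tens v w).

Definition tlift_fun V W U (b : V -> W -> U) (t : tensor V W) : U :=
  \sum_i \sum_j t i j *: b (vbasis {:V})`_i (vbasis {:W})`_j.

Lemma tlift_fun_is_linear V W U (b : V -> W -> U) : linear (tlift_fun b).
Proof.
move=> c t t'; rewrite /tlift_fun scaler_sumr -big_split; apply: eq_bigr => i _.
rewrite /= scaler_sumr -big_split; apply: eq_bigr => j _ /=.
by rewrite !mxE scalerDl scalerA.
Qed.
HB.instance Definition _ V W U (b : V -> W -> U) :=
  GRing.isLinear.Build F (tensor V W) U *:%R (tlift_fun b)
    (tlift_fun_is_linear b).

(* The linear map on V ⊗ W induced by b, meaningful when b is bilinear. *)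
Definition tlift V W U (b : V -> W -> U) : 'Hom(tensor V W, U) :=
  linfun (tlift_fun b).

Lemma tens_linearl V W (w : W) : linear (fun v : V => v ⊗ w).
Proof. by move=> c v v'; apply/matrixP=> i j; rewrite !mxE linearP mulrDl mulrA. Qed.

Lemma tens_linearr V W (v : V) : linear (fun w : W => v ⊗ w).
Proof.
by move=> c w w'; apply/matrixP=> i j; rewrite !mxE linearP mulrDr mulrCA.
Qed.

Lemma tens_basisE V W (t : tensor V W) :
  t = \sum_i \sum_j t i j *: ((vbasis {:V})`_i ⊗ (vbasis {:W})`_j).
Proof.
have fV := basis_free (vbasisP {:V}); have fW := basis_free (vbasisP {:W}).
apply/matrixP=> k l; rewrite summxE (bigD1 k) //= summxE (bigD1 l) //=.
rewrite !mxE !coord_free // !eqxx !mulr1 big1 ?addr0 => [|j nj].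
  rewrite big1 ?addr0 // => i ni; rewrite summxE big1 // => j _.
  by rewrite !mxE !coord_free // (negPf ni) mul0r mulr0.
by rewrite !mxE !coord_free // (negPf nj) !mulr0.
Qed.

Lemma tlift_tens V W U (b : V -> W -> U) (v : V) (w : W) :
    (forall w', linear (b^~ w')) -> (forall v', linear (b v')) ->
  tlift b (v ⊗ w) = b v w.
Proof.
move=> bl br; rewrite lfunE /= /tlift_fun.
pose bl' w' : {linear V -> U} :=
  HB.pack (b^~ w') (GRing.isLinear.Build F V U *:%R _ (bl w')).
pose br' v' : {linear W -> U} :=
  HB.pack (b v') (GRing.isLinear.Build F W U *:%R _ (br v')).
rewrite {2}(coord_vbasis (memvf v)) -[RHS]/(bl' w _) linear_sum.
apply: eq_bigr => i _; rewrite linearZ /= {2}(coord_vbasis (memvf w)).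
rewrite -[b _ (\sum_(i < _) _)]/(br' _ _) linear_sum scaler_sumr.
by apply: eq_bigr => j _; rewrite linearZ /= mxE scalerA.
Qed.

Lemma tensor_ext V W U (f g : 'Hom(tensor V W, U)) :
  (forall v w, f (v ⊗ w) = g (v ⊗ w)) -> f = g.
Proof.
move=> fg; apply/lfunP=> t; rewrite (tens_basisE t) !linear_sum.
apply: eq_bigr => i _; rewrite !linear_sum; apply: eq_bigr => j _.
by rewrite !linearZ /= fg.
Qed.

Definition tmap V W U X (f : 'Hom(V, U)) (g : 'Hom(W, X)) :
    'Hom(tensor V W, tensor U X) :=
  tlift (fun v w => f v ⊗ g w).

Definition tswap V W : 'Hom(tensor V W, tensor W V) :=
  tlift (fun v w => w ⊗ v).

Definition tassoc V W U :
    'Hom(tensor V (tensor W U), tensor (tensor V W) U) :=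
  tlift (fun v t => tlift (fun w u => v ⊗ w ⊗ u) t).

Definition is_antisymmetric_tensor V (s : tensor V V) : Prop := s = - tswap V V s.

End Tensor.

Notation "v ⊗ w" := (tens v w) : ring_scope.

Section DualAndSum.
Variable F : fieldType.
Implicit Types U V W : vectType F.

Definition dual V : vectType F := 'Hom(V, F^o).

Definition transpose_fun U V (f : 'Hom(U, V)) (g : dual V) : dual U :=
  (g \o f)%VF.

Lemma transpose_fun_is_linear U V (f : 'Hom(U, V)) : linear (transpose_fun f).
Proof.
by move=> c g h; apply/lfunP=> x; rewrite comp_lfunE !(add_lfunE, scale_lfunE, comp_lfunE).
Qed.
HB.instance Definition _ U V (f : 'Hom(U, V)) :=
  GRing.isLinear.Build F (dual V) (dual U) *:%R (transpose_fun f)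
    (transpose_fun_is_linear f).

Definition transpose U V (f : 'Hom(U, V)) : 'Hom(dual V, dual U) :=
  linfun (transpose_fun f).

Definition dsum_fun V W (f : 'End(V)) (g : 'End(W)) (x : V * W) : V * W :=
  (f x.1, g x.2).

Lemma dsum_fun_is_linear V W (f : 'End(V)) (g : 'End(W)) : linear (dsum_fun f g).
Proof. by move=> c x y; rewrite /dsum_fun /= !linearP. Qed.
HB.instance Definition _ V W (f : 'End(V)) (g : 'End(W)) :=
  GRing.isLinear.Build F (V * W)%type (V * W)%type *:%R (dsum_fun f g)
    (dsum_fun_is_linear f g).

Definition dsum V W (f : 'End(V)) (g : 'End(W)) : 'End((V * W)%type) :=
  linfun (dsum_fun f g).

End DualAndSum.

Section Algebras.
Variables (F : fieldType) (A : vectType F) (m : nat).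
Implicit Types (mul succ prec : A -> A -> A) (d eth : 'I_m -> 'End(A)).

Record is_bilinear mul : Prop := {
  bilinear_left : forall b, linear (mul^~ b);
  bilinear_right : forall a, linear (mul a) }.

(* As [mul] is a bare function, these are the multiplication operators only    *)
(* when [mul] is bilinear ([linfun] coincides with its argument iff linear).   *)
Definition Lop mul (a : A) : 'End(A) := linfun (mul a).
Definition Rop mul (a : A) : 'End(A) := linfun (mul^~ a).

Record is_algebra mul : Prop := {
  algebra_bilinear : is_bilinear mul;
  algebra_assoc : associative mul }.

Definition pairwise_commuting d : Prop :=
  forall k l, (d k \o d l)%VF = (d l \o d k)%VF.

Definition is_derivation mul (f : 'End(A)) : Prop :=
  forall a b, f (mul a b) = mul (f a) b + mul a (f b).

Record is_diff_algebra mul d : Prop := {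
  diff_algebra_algebra : is_algebra mul;
  diff_algebra_comm : pairwise_commuting d;
  diff_algebra_der : forall k, is_derivation mul (d k) }.

Record is_dendriform succ prec : Prop := {
  dendriform_succ : is_bilinear succ;
  dendriform_prec : is_bilinear prec;
  dendriform_pp : forall a b c,
    prec (prec a b) c = prec a (prec b c + succ b c);
  dendriform_sp : forall a b c,
    prec (succ a b) c = succ a (prec b c);
  dendriform_ss : forall a b c,
    succ (prec a b + succ a b) c = succ a (succ b c) }.

Record is_diff_dendriform succ prec d : Prop := {
  diff_dendriform_dendriform : is_dendriform succ prec;
  diff_dendriform_comm : pairwise_commuting d;
  diff_dendriform_succ : forall k, is_derivation succ (d k);
  diff_dendriform_prec : forall k, is_derivation prec (d k) }.

Definition dendriform_mul succ prec (a b : A) : A := succ a b + prec a b.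

Record is_admissible mul d eth : Prop := {
  admissible_diff_algebra : is_diff_algebra mul d;
  admissible_comm : pairwise_commuting eth;
  admissible_l : forall k a b,
    mul (eth k a) b = mul a (d k b) + eth k (mul a b);
  admissible_r : forall k a b,
    mul a (eth k b) = mul (d k a) b + eth k (mul a b) }.

Local Notation AA := (tensor A A).

(* For s = \sum_i a_i ⊗ b_i and mul bilinear, [quad_lift (fun a b a' b' => ..) s] *)
(* is the sum over all (i, j) of the given expression at a_i, b_i, a_j, b_j.      *)
Definition quad_lift (V : vectType F) (q : A -> A -> A -> A -> V) (s : AA) : V :=
  tlift (fun a b => tlift (fun a' b' => q a b a' b') s) s.

Definition s12s13 mul (s : AA) : tensor AA A :=
  quad_lift (fun ai bi aj bj => mul ai aj ⊗ bi ⊗ bj) s.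
Definition s13s23 mul (s : AA) : tensor AA A :=
  quad_lift (fun ai bi aj bj => ai ⊗ aj ⊗ mul bi bj) s.
Definition s23s12 mul (s : AA) : tensor AA A :=
  quad_lift (fun ai bi aj bj => aj ⊗ mul ai bj ⊗ bi) s.

Record is_admissible_AYBE_solution mul d eth (s : AA) : Prop := {
  AYBE_eq : s12s13 mul s + s13s23 mul s - s23s12 mul s = 0;
  AYBE_d_eth : forall k, (tmap (d k) \1 - tmap \1 (eth k))%VF s = 0;
  AYBE_eth_d : forall k, (tmap (eth k) \1 - tmap \1 (d k))%VF s = 0 }.

Definition is_coassociative (Delta : 'Hom(A, AA)) : Prop :=
  (tmap Delta \1 \o Delta)%VF = (tassoc A A A \o tmap \1 Delta \o Delta)%VF.

Record is_ASI_bialgebra mul (Delta : 'Hom(A, AA)) : Prop := {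
  ASI_algebra : is_algebra mul;
  ASI_coassoc : is_coassociative Delta;
  ASI_mul : forall a b,
    Delta (mul a b) =
      tmap (Rop mul b) \1%VF (Delta a) + tmap \1%VF (Lop mul a) (Delta b);
  ASI_sym : forall a b,
    (tmap (Lop mul a) \1 - tmap \1 (Rop mul a))%VF (Delta b) =
      tswap A A ((tmap \1 (Rop mul b) - tmap (Lop mul b) \1)%VF (Delta a)) }.

Record is_diff_ASI_bialgebra mul (Delta : 'Hom(A, AA)) d eth : Prop := {
  diff_ASI_bialgebra : is_ASI_bialgebra mul Delta;
  diff_ASI_admissible : is_admissible mul d eth;
  diff_ASI_coder : forall k,
    (Delta \o eth k)%VF = ((tmap (eth k) \1 + tmap \1 (eth k)) \o Delta)%VF;
  diff_ASI_d_l : forall k,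
    (tmap (d k) \1 \o Delta)%VF =
      (tmap \1 (eth k) \o Delta)%VF + (Delta \o d k)%VF;
  diff_ASI_d_r : forall k,
    (tmap \1 (d k) \o Delta)%VF =
      (tmap (eth k) \1 \o Delta)%VF + (Delta \o d k)%VF }.

End Algebras.

Section QuadLift.
Variables (F : fieldType) (A V : vectType F).

Lemma quad_liftE (q : A -> A -> A -> A -> V) r (a b : 'I_r -> A) :
    (forall y z t, linear (fun x => q x y z t)) ->
    (forall x z t, linear (fun y => q x y z t)) ->
    (forall x y t, linear (fun z => q x y z t)) ->
    (forall x y z, linear (fun t => q x y z t)) ->
  quad_lift q (\sum_i a i ⊗ b i) =
    \sum_i \sum_j q (a i) (b i) (a j) (b j).
Proof.
move=> q1 q2 q3 q4; rewrite /quad_lift linear_sum; apply: eq_bigr => i _ /=.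
have inner x y : tlift (fun z t => q x y z t) (\sum_i a i ⊗ b i) =
                 \sum_j q x y (a j) (b j).
  by rewrite linear_sum; apply: eq_bigr => j _ /=; rewrite tlift_tens.
rewrite tlift_tens ?inner //.
  move=> y c x x'; rewrite !inner scaler_sumr -big_split.
  by apply: eq_bigr => j _; rewrite q1.
move=> x c y y'; rewrite !inner scaler_sumr -big_split.
by apply: eq_bigr => j _; rewrite q2.
Qed.

End QuadLift.

Section Semidirect.
Variables (F : fieldType) (A V : vectType F).

(* A ⋉_{l,r} V : (a + v)(b + w) = ab + l(a) w + r(b) v *)
Definition semidirect_mul (mul : A -> A -> A) (l r : A -> 'End(V))
    (x y : A * V) : A * V :=
  (mul x.1 y.1, l x.1 y.2 + r y.1 x.2).

End Semidirect.

Section DendriformHat.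
Variables (F : fieldType) (A : vectType F) (succ prec : A -> A -> A).

Definition hat : vectType F := (A * dual A)%type.

(* the product of A ⋉_{R_prec^*, L_succ^*} A^* *)
Definition hat_mul : hat -> hat -> hat :=
  semidirect_mul (dendriform_mul succ prec)
    (fun a => transpose (Rop prec a)) (fun a => transpose (Lop succ a)).

Definition hat_inl (a : A) : hat := (a, 0).
Definition hat_inr (f : dual A) : hat := (0, f).

End DendriformHat.

(* Main.v *)
Require Import Defs.
From HB Require Import structures.
From mathcomp Require Import all_boot all_algebra.
From mathcomp Require Import ring.

Import GRing.Theory.
Local Open Scope ring_scope.

(** Two independent facts are combined.

    The first holds in any admissible differential algebra: an antisymmetric
    solution [s] of the admissible AYBE makes the coboundary
    [x |-> (id ⊗ L x - R x ⊗ id) s] a differential ASI bialgebra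
    ([coboundary_diff_ASI]). The cocycle condition is associativity alone, and
    the symmetry condition is associativity and antisymmetry. In the defect of
    coassociativity at [x], the terms having [x] in the middle slot cancel by
    associativity; the remaining terms are the AYBE expression of [s], acted on
    by [L x] in the last slot and by [R x] in the first ([coboundary_coassoc]).
    For the differential conditions, the two linear equations satisfied by [s]
    move a derivation from one leg to the other while replacing it by its
    admissible partner ([tmap_d_eth], [tmap_eth_d]), and admissibility expresses
    [L] and [R] of a differentiated element through [L x] and [R x].

    The second is that the canonical tensor of [A ⊕ A^*] is such a solution.
    Under the pairing with [A], every identity of the semidirect product becomes
    an identity of the dendriform operations ([hat_mul2]), which settles
    associativity and admissibility. For the AYBE, the canonical tensor
    represents the identity map, so endomorphisms slide between its legs
    ([casimir]). Since [A] acts on [A^*] by transposes of [prec] and [succ],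
    sliding turns each mixed product in the AYBE into two dual basis vectors and
    one leg that is [prec] or [succ] of two basis vectors. Sorted by the slot that
    holds this leg, the three terms in which two elements of [A] are multiplied
    give [succ + prec], one for each slot, and the six mixed terms cancel them. *)

(** * Tensor calculus *)

Section TensorCalculus.
Set Implicit Arguments.
Variable F : fieldType.
Implicit Types U V W X Y Z : vectType F.

Lemma tensDl V W (v v' : V) (w : W) : (v + v') ⊗ w = v ⊗ w + v' ⊗ w.
Proof. by have := tens_linearl w 1 v v'; rewrite !scale1r. Qed.

Lemma tensDr V W (v : V) (w w' : W) : v ⊗ (w + w') = v ⊗ w + v ⊗ w'.
Proof. by have := tens_linearr v 1 w w'; rewrite !scale1r. Qed.

Lemma tensPl V W c (v v' : V) (w : W) :
  (c *: v + v') ⊗ w = c *: (v ⊗ w) + v' ⊗ w.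
Proof. exact: tens_linearl. Qed.

Lemma tensPr V W c (v : V) (w w' : W) :
  v ⊗ (c *: w + w') = c *: (v ⊗ w) + v ⊗ w'.
Proof. exact: tens_linearr. Qed.

Lemma tensZl V W c (v : V) (w : W) : (c *: v) ⊗ w = c *: (v ⊗ w).
Proof. by apply/matrixP=> i j; rewrite !mxE linearZ mulrA. Qed.

Lemma tensZr V W c (v : V) (w : W) : v ⊗ (c *: w) = c *: (v ⊗ w).
Proof. by apply/matrixP=> i j; rewrite !mxE linearZ mulrCA. Qed.

Lemma tensNl V W (v : V) (w : W) : (- v) ⊗ w = - (v ⊗ w).
Proof. by rewrite -scaleN1r tensZl scaleN1r. Qed.

Lemma tensNr V W (v : V) (w : W) : v ⊗ (- w) = - (v ⊗ w).
Proof. by rewrite -scaleN1r tensZr scaleN1r. Qed.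

Lemma tens0l V W (w : W) : (0 : V) ⊗ w = 0.
Proof. by rewrite -(scale0r 0) tensZl scale0r. Qed.

Lemma tens0r V W (v : V) : v ⊗ (0 : W) = 0.
Proof. by rewrite -(scale0r 0) tensZr scale0r. Qed.

Lemma tens_suml V W (I : finType) (v : I -> V) (w : W) :
  (\sum_i v i) ⊗ w = \sum_i v i ⊗ w.
Proof.
by apply: (big_morph (fun v => v ⊗ w)) => [? ?|]; rewrite ?tensDl ?tens0l.
Qed.

Lemma tens_sumr V W (I : finType) (v : V) (w : I -> W) :
  v ⊗ (\sum_i w i) = \sum_i v ⊗ w i.
Proof.
by apply: (big_morph (tens v)) => [? ?|]; rewrite ?tensDr ?tens0r.
Qed.

(** Writing a tensor as a sum of pure ones makes the quadratic expressions of
    the AYBE computable by [quad_liftE]. *)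
Lemma tensor_sum V W (t : tensor V W) :
  exists r (v : 'I_r -> V) (w : 'I_r -> W), t = \sum_i v i ⊗ w i.
Proof.
exists (\dim {:V}), (fun i => (vbasis {:V})`_i).
exists (fun i => \sum_j t i j *: (vbasis {:W})`_j).
rewrite {1}(tens_basisE t); apply: eq_bigr => i _; rewrite tens_sumr.
by apply: eq_bigr => j _; rewrite tensZr.
Qed.

Lemma tmap_tens V W U X (f : 'Hom(V, U)) (g : 'Hom(W, X)) v w :
  tmap f g (v ⊗ w) = f v ⊗ g w.
Proof.
by apply: tlift_tens => [? ? ? ?|? ? ? ?];
   rewrite linearP (tensDl, tensDr) (tensZl, tensZr).
Qed.

Lemma tswap_tens V W (v : V) (w : W) : tswap V W (v ⊗ w) = w ⊗ v.
Proof.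
by apply: tlift_tens => [? ? ? ?|? ? ? ?];
   rewrite (tensDl, tensDr) (tensZl, tensZr).
Qed.

Lemma tassoc_tens V W U (v : V) (w : W) (u : U) :
  tassoc V W U (v ⊗ (w ⊗ u)) = v ⊗ w ⊗ u.
Proof.
have inner v' w' u' :
    tlift (fun w u => v' ⊗ w ⊗ u) (w' ⊗ u') = v' ⊗ w' ⊗ u' :> tensor _ U.
  by apply: tlift_tens => [? ? ? ?|? ? ? ?];
     rewrite ?tensDr ?tensZr ?tensDl ?tensZl.
rewrite /tassoc tlift_tens ?inner // => [t c x y|x c t t']; last first.
  by rewrite linearP.
have [r [a [b ->]]] := tensor_sum t.
rewrite !linear_sum -big_split; apply: eq_bigr => i _ /=.
by rewrite !inner !tensDl !tensZl.
Qed.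

Lemma tmap_comp V W U X Y Z (f : 'Hom(U, Y)) (g : 'Hom(X, Z))
    (f' : 'Hom(V, U)) (g' : 'Hom(W, X)) t :
  tmap f g (tmap f' g' t) = tmap (f \o f')%VF (g \o g')%VF t.
Proof.
rewrite -comp_lfunE; congr (fun_of_lfun _ t); apply: tensor_ext => v w.
by rewrite comp_lfunE !tmap_tens !comp_lfunE.
Qed.

Lemma tswap_tmap V W U X (f : 'Hom(V, U)) (g : 'Hom(W, X)) t :
  tswap U X (tmap f g t) = tmap g f (tswap V W t).
Proof.
rewrite -!comp_lfunE; congr (fun_of_lfun _ t); apply: tensor_ext => v w.
by rewrite !comp_lfunE tmap_tens !tswap_tens tmap_tens.
Qed.

Lemma tmapDl V W U X (f f' : 'Hom(V, U)) (g : 'Hom(W, X)) t :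
  tmap (f + f') g t = tmap f g t + tmap f' g t.
Proof.
rewrite -add_lfunE; congr (fun_of_lfun _ t); apply: tensor_ext => v w.
by rewrite add_lfunE !tmap_tens add_lfunE tensDl.
Qed.

Lemma tmapDr V W U X (f : 'Hom(V, U)) (g g' : 'Hom(W, X)) t :
  tmap f (g + g') t = tmap f g t + tmap f g' t.
Proof.
rewrite -add_lfunE; congr (fun_of_lfun _ t); apply: tensor_ext => v w.
by rewrite add_lfunE !tmap_tens add_lfunE tensDr.
Qed.

Lemma tmapZl V W U X c (f : 'Hom(V, U)) (g : 'Hom(W, X)) t :
  tmap (c *: f) g t = c *: tmap f g t.
Proof.
rewrite -scale_lfunE; congr (fun_of_lfun _ t); apply: tensor_ext => v w.
by rewrite scale_lfunE !tmap_tens scale_lfunE tensZl.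
Qed.

Lemma tmapZr V W U X c (f : 'Hom(V, U)) (g : 'Hom(W, X)) t :
  tmap f (c *: g) t = c *: tmap f g t.
Proof.
rewrite -scale_lfunE; congr (fun_of_lfun _ t); apply: tensor_ext => v w.
by rewrite scale_lfunE !tmap_tens scale_lfunE tensZr.
Qed.

Lemma tmapBl V W U X (f f' : 'Hom(V, U)) (g : 'Hom(W, X)) t :
  tmap (f - f') g t = tmap f g t - tmap f' g t.
Proof. by rewrite -scaleN1r tmapDl tmapZl scaleN1r. Qed.

Lemma tmapBr V W U X (f : 'Hom(V, U)) (g g' : 'Hom(W, X)) t :
  tmap f (g - g') t = tmap f g t - tmap f g' t.
Proof. by rewrite -scaleN1r tmapDr tmapZr scaleN1r. Qed.

End TensorCalculus.

(** * Bialgebras from antisymmetric solutions of the AYBE *)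

Section Coboundary.
Set Implicit Arguments.
Variables (F : fieldType) (A : vectType F) (mul : A -> A -> A).

Section Operators.
Hypothesis bil : is_bilinear mul.

Lemma bilinearPl c x y b : mul (c *: x + y) b = c *: mul x b + mul y b.
Proof. exact: bilinear_left bil b c x y. Qed.

Lemma bilinearPr c x y a : mul a (c *: x + y) = c *: mul a x + mul a y.
Proof. exact: bilinear_right bil a c x y. Qed.

Lemma bilinear0l b : mul 0 b = 0.
Proof. by have := bilinearPl (-1) 0 0 b; rewrite !scaleN1r !addNr. Qed.

Lemma bilinear0r a : mul a 0 = 0.
Proof. by have := bilinearPr (-1) 0 0 a; rewrite !scaleN1r !addNr. Qed.

Lemma bilinearNl a b : mul (- a) b = - mul a b.
Proof.
by have := bilinearPl (-1) a 0 b; rewrite !scaleN1r bilinear0l !addr0.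
Qed.

Lemma bilinearNr a b : mul a (- b) = - mul a b.
Proof.
by have := bilinearPr (-1) b 0 a; rewrite !scaleN1r bilinear0r !addr0.
Qed.

Lemma LopE a b : Lop mul a b = mul a b.
Proof.
pose h : {linear A -> A} :=
  HB.pack (mul a) (GRing.isLinear.Build F A A *:%R _ (bilinear_right bil a)).
exact: (lfunE h b).
Qed.

Lemma RopE a b : Rop mul a b = mul b a.
Proof.
pose h : {linear A -> A} :=
  HB.pack (mul^~ a) (GRing.isLinear.Build F A A *:%R _ (bilinear_left bil a)).
exact: (lfunE h b).
Qed.

Lemma Lop_linear : linear (Lop mul).
Proof.
move=> c a b; apply/lfunP=> x.
by rewrite add_lfunE scale_lfunE !LopE bilinearPl.
Qed.

Lemma Rop_linear : linear (Rop mul).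
Proof.
move=> c a b; apply/lfunP=> x.
by rewrite add_lfunE scale_lfunE !RopE bilinearPr.
Qed.

Lemma coboundary_linear (s : tensor A A) :
  linear (fun x => (tmap \1 (Lop mul x) - tmap (Rop mul x) \1)%VF s).
Proof.
move=> c x y; rewrite !(add_lfunE, opp_lfunE) Lop_linear Rop_linear.
rewrite tmapDl tmapDr tmapZl tmapZr scalerBr opprD.
by rewrite addrACA.
Qed.

Definition coboundary (s : tensor A A) : 'Hom(A, tensor A A) :=
  linfun (fun x => (tmap \1 (Lop mul x) - tmap (Rop mul x) \1)%VF s).

Lemma coboundaryE s x :
  coboundary s x = tmap \1 (Lop mul x) s - tmap (Rop mul x) \1 s.
Proof.
pose h : {linear A -> tensor A A} := HB.pack
  (fun x => (tmap \1 (Lop mul x) - tmap (Rop mul x) \1)%VF s)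
  (GRing.isLinear.Build F A (tensor A A) *:%R _ (coboundary_linear s)).
by rewrite -[coboundary s]/(linfun h) lfunE /= add_lfunE opp_lfunE.
Qed.

Lemma coboundary_sum r (u v : 'I_r -> A) x :
  coboundary (\sum_i u i ⊗ v i) x =
  \sum_i (u i ⊗ mul x (v i) - mul (u i) x ⊗ v i).
Proof.
rewrite coboundaryE !linear_sum -big_split; apply: eq_bigr => i _.
by rewrite /= !tmap_tens !id_lfunE LopE RopE.
Qed.

Lemma s12s13_sum r (u v : 'I_r -> A) :
  s12s13 mul (\sum_i u i ⊗ v i) =
  \sum_i \sum_j mul (u i) (u j) ⊗ v i ⊗ v j.
Proof.
rewrite /s12s13 quad_liftE // => ? ? ? c ? ?.
- by rewrite bilinearPl 2!tensPl.
- by rewrite tensPr tensPl.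
- by rewrite bilinearPr 2!tensPl.
- by rewrite tensPr.
Qed.

Lemma s13s23_sum r (u v : 'I_r -> A) :
  s13s23 mul (\sum_i u i ⊗ v i) =
  \sum_i \sum_j u i ⊗ u j ⊗ mul (v i) (v j).
Proof.
rewrite /s13s23 quad_liftE // => ? ? ? c ? ?.
- by rewrite 2!tensPl.
- by rewrite bilinearPl tensPr.
- by rewrite tensPr tensPl.
- by rewrite bilinearPr tensPr.
Qed.

Lemma s23s12_sum r (u v : 'I_r -> A) :
  s23s12 mul (\sum_i u i ⊗ v i) =
  \sum_i \sum_j u j ⊗ mul (u i) (v j) ⊗ v i.
Proof.
rewrite /s23s12 quad_liftE // => ? ? ? c ? ?.
- by rewrite bilinearPl tensPr tensPl.
- by rewrite tensPr.
- by rewrite 2!tensPl.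
- by rewrite bilinearPr tensPr tensPl.
Qed.

End Operators.

Section AssociativeOperators.
Hypothesis alg : is_algebra mul.
Let bil := algebra_bilinear alg.

Lemma LopM a b : Lop mul (mul a b) = (Lop mul a \o Lop mul b)%VF.
Proof.
by apply/lfunP=> x; rewrite comp_lfunE !(LopE bil) (algebra_assoc alg).
Qed.

Lemma RopM a b : Rop mul (mul a b) = (Rop mul b \o Rop mul a)%VF.
Proof.
by apply/lfunP=> x; rewrite comp_lfunE !(RopE bil) (algebra_assoc alg).
Qed.

Lemma Lop_Rop a b : (Lop mul a \o Rop mul b = Rop mul b \o Lop mul a)%VF.
Proof.
by apply/lfunP=> x; rewrite !comp_lfunE !(RopE bil, LopE bil) (algebra_assoc alg).
Qed.

Lemma coboundary_mul s a b :
  coboundary s (mul a b) =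
  tmap (Rop mul b) \1 (coboundary s a) + tmap \1 (Lop mul a) (coboundary s b).
Proof.
rewrite !(coboundaryE bil) !linearB /= !tmap_comp LopM RopM.
rewrite !comp_lfun1l !comp_lfun1r [X in _ = X]addrC.
by rewrite addrA subrK.
Qed.

Lemma coboundary_sym s a b : is_antisymmetric_tensor s ->
  (tmap (Lop mul a) \1 - tmap \1 (Rop mul a))%VF (coboundary s b) =
  tswap A A ((tmap \1 (Rop mul b) - tmap (Lop mul b) \1)%VF (coboundary s a)).
Proof.
move=> anti; have flip f g : tswap A A (tmap f g s) = - tmap g f s.
  by rewrite tswap_tmap {2}anti linearN opprK.
rewrite !(coboundaryE bil) !(add_lfunE, opp_lfunE) !linearB /= !tmap_comp.
rewrite !flip !comp_lfun1l !comp_lfun1r !Lop_Rop !opprK.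
by rewrite addrACA addrC.
Qed.

(** With [s = \sum_i u_i ⊗ v_i], the terms of both sides that carry [x] in the
    middle slot are equal by associativity, and the others differ by the images
    of the AYBE expression under [L] and [R]. *)
Lemma coboundary_coassoc s :
  s12s13 mul s + s13s23 mul s - s23s12 mul s = 0 ->
  is_coassociative (coboundary s).
Proof.
have [r [u [v def_s]]] := tensor_sum s.
move/subr0_eq=> aybe; apply/lfunP=> x; rewrite !comp_lfunE.
pose L := tmap (\1%VF : 'End(tensor A A)) (Lop mul x).
pose R := tmap (tmap (Rop mul x) (\1%VF : 'End(A))) (\1%VF : 'End(A)).
have sumL I (f g h : I -> I -> A) (r1 r2 : seq I) :
    L (\sum_(i <- r1) \sum_(j <- r2) f i j ⊗ g i j ⊗ h i j) =
    \sum_(i <- r1) \sum_(j <- r2) f i j ⊗ g i j ⊗ mul x (h i j).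
  rewrite linear_sum; apply: eq_bigr => i _; rewrite linear_sum.
  by apply: eq_bigr => j _; rewrite /= tmap_tens id_lfunE (LopE bil).
have sumR I (f g h : I -> I -> A) (r1 r2 : seq I) :
    R (\sum_(i <- r1) \sum_(j <- r2) f i j ⊗ g i j ⊗ h i j) =
    \sum_(i <- r1) \sum_(j <- r2) mul (f i j) x ⊗ g i j ⊗ h i j.
  rewrite linear_sum; apply: eq_bigr => i _; rewrite linear_sum.
  by apply: eq_bigr => j _; rewrite /= !tmap_tens !id_lfunE (RopE bil).
(* the terms with [x] in the middle slot, common to both sides *)
pose M := \sum_i \sum_j u j ⊗ mul (mul (u i) x) (v j) ⊗ v i.
have -> : tmap (coboundary s) \1 (coboundary s x) =
    L (s23s12 mul s) - L (s12s13 mul s) - (M - R (s12s13 mul s)).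
  have -> : s12s13 mul s = \sum_i \sum_j mul (u j) (u i) ⊗ v j ⊗ v i.
    by rewrite def_s (s12s13_sum bil) exchange_big.
  rewrite def_s (s23s12_sum bil) !sumL sumR (coboundary_sum bil) linear_sum.
  rewrite -!sumrB.
  apply: eq_bigr => i _; rewrite linearB /= !tmap_tens !id_lfunE.
  rewrite !(coboundary_sum bil) !tens_suml -!sumrB.
  by apply: eq_bigr => j _; rewrite !tensDl !tensNl (algebra_assoc alg).
have -> : tassoc A A A (tmap \1 (coboundary s) (coboundary s x)) =
    L (s13s23 mul s) - M - (R (s13s23 mul s) - R (s23s12 mul s)).
  have -> : s23s12 mul s = \sum_i \sum_j u i ⊗ mul (u j) (v i) ⊗ v j.
    by rewrite def_s (s23s12_sum bil) exchange_big.
  have -> : M = \sum_i \sum_j u i ⊗ mul (u j) (mul x (v i)) ⊗ v j.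
    rewrite /M exchange_big; apply: eq_bigr => i _; apply: eq_bigr => j _.
    by rewrite (algebra_assoc alg).
  rewrite def_s (s13s23_sum bil) !sumL !sumR (coboundary_sum bil).
  rewrite [tmap _ _ _]linear_sum [tassoc _ _ _ _]linear_sum -!sumrB.
  apply: eq_bigr => i _; rewrite /= [tmap _ _ _]linearB [tassoc _ _ _ _]linearB.
  rewrite /= !tmap_tens !id_lfunE !(coboundary_sum bil) !tens_sumr.
  rewrite 2![tassoc _ _ _ _]linear_sum -!sumrB; apply: eq_bigr => j _.
  rewrite /= !tensDr !tensNr 2![tassoc _ _ _ _]linearB /= !tassoc_tens.
  by rewrite !(algebra_assoc alg).
rewrite -aybe [L (_ + _)]linearD [R (_ + _)]linearD /= [X in X - _ = _]addrAC.
by rewrite subrr add0r !opprB addrK addrA addrAC.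
Qed.

End AssociativeOperators.

Section Admissible.
Variables (m : nat) (d eth : 'I_m -> 'End(A)) (s : tensor A A).
Hypotheses (adm : is_admissible mul d eth) (k : 'I_m).
Let alg := diff_algebra_algebra (admissible_diff_algebra adm).
Let bil := algebra_bilinear alg.

Lemma Lop_eth x :
  Lop mul (eth k x) = ((Lop mul x \o d k) + (eth k \o Lop mul x))%VF.
Proof.
apply/lfunP=> y; rewrite add_lfunE !comp_lfunE !(LopE bil).
exact: admissible_l adm k x y.
Qed.

Lemma Rop_eth x :
  Rop mul (eth k x) = ((Rop mul x \o d k) + (eth k \o Rop mul x))%VF.
Proof.
apply/lfunP=> y; rewrite add_lfunE !comp_lfunE !(RopE bil).
exact: admissible_r adm k y x.
Qed.

(** Rewriting [L (d x)] and [R (d x)] by admissibility, rather than by the Leibniz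
    rule, trades [d] for its partner [eth]. In [coboundary_d_l] and
    [coboundary_d_r] exactly one of the two multiplications has to be rewritten
    in this way and the other one by the Leibniz rule. *)
Lemma Lop_d x :
  Lop mul (d k x) = ((Lop mul x \o eth k) - (eth k \o Lop mul x))%VF.
Proof.
apply/lfunP=> y; rewrite add_lfunE opp_lfunE !comp_lfunE !(LopE bil).
by rewrite (admissible_r adm) addrK.
Qed.

Lemma Rop_d x :
  Rop mul (d k x) = ((Rop mul x \o eth k) - (eth k \o Rop mul x))%VF.
Proof.
apply/lfunP=> y; rewrite add_lfunE opp_lfunE !comp_lfunE !(RopE bil).
by rewrite (admissible_l adm) addrK.
Qed.

Lemma Lop_d_der x :
  Lop mul (d k x) = ((d k \o Lop mul x) - (Lop mul x \o d k))%VF.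
Proof.
apply/lfunP=> y; rewrite add_lfunE opp_lfunE !comp_lfunE !(LopE bil).
by rewrite (diff_algebra_der (admissible_diff_algebra adm)) addrK.
Qed.

Lemma Rop_d_der x :
  Rop mul (d k x) = ((d k \o Rop mul x) - (Rop mul x \o d k))%VF.
Proof.
apply/lfunP=> y; rewrite add_lfunE opp_lfunE !comp_lfunE !(RopE bil).
by rewrite (diff_algebra_der (admissible_diff_algebra adm)) addrC addKr.
Qed.

Hypothesis sol : is_admissible_AYBE_solution mul d eth s.

(** An endomorphism composed on one leg of [s] can be carried over to the other
    leg: this is how the two linear equations on [s] are used. *)
Lemma tmap_d_eth (f g : 'End(A)) :
  tmap (f \o d k)%VF g s = tmap f (g \o eth k)%VF s.
Proof.
have := AYBE_d_eth sol k; rewrite add_lfunE opp_lfunE => /subr0_eq.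
by move/(congr1 (tmap f g)); rewrite !tmap_comp !comp_lfun1r.
Qed.

Lemma tmap_eth_d (f g : 'End(A)) :
  tmap (f \o eth k)%VF g s = tmap f (g \o d k)%VF s.
Proof.
have := AYBE_eth_d sol k; rewrite add_lfunE opp_lfunE => /subr0_eq.
by move/(congr1 (tmap f g)); rewrite !tmap_comp !comp_lfun1r.
Qed.

Lemma coboundary_eth x :
  coboundary s (eth k x) =
  (tmap (eth k) \1 + tmap \1 (eth k))%VF (coboundary s x).
Proof.
rewrite add_lfunE !(coboundaryE bil) !linearB /= !tmap_comp Lop_eth Rop_eth.
rewrite tmapDr tmapDl tmap_d_eth -tmap_eth_d !comp_lfun1l !comp_lfun1r.
by rewrite [X in _ - X]addrC opprD addrACA.
Qed.

Lemma coboundary_d_l x :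
  tmap (d k) \1 (coboundary s x) =
  tmap \1 (eth k) (coboundary s x) + coboundary s (d k x).
Proof.
rewrite !(coboundaryE bil) !linearB /= !tmap_comp Lop_d Rop_d_der tmapBr tmapBl.
rewrite -(tmap_d_eth \1 (Lop mul x)) (tmap_d_eth (Rop mul x) \1).
rewrite !comp_lfun1l !comp_lfun1r.
by rewrite opprB addrACA addKr addrCA subrr addr0.
Qed.

Lemma coboundary_d_r x :
  tmap \1 (d k) (coboundary s x) =
  tmap (eth k) \1 (coboundary s x) + coboundary s (d k x).
Proof.
rewrite !(coboundaryE bil) !linearB /= !tmap_comp Lop_d_der Rop_d tmapBr tmapBl.
rewrite -(tmap_eth_d \1 (Lop mul x)) (tmap_eth_d (Rop mul x) \1).
rewrite !comp_lfun1l !comp_lfun1r.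
by rewrite opprB addrACA addKr addrCA subrr addr0.
Qed.

End Admissible.

(** Only coassociativity needs the quadratic equation on [s]; the differential
    axioms come from the two linear ones, and the symmetry axiom from the
    antisymmetry of [s]. *)
Lemma coboundary_diff_ASI m (d eth : 'I_m -> 'End(A)) s :
  is_admissible mul d eth -> is_antisymmetric_tensor s ->
  is_admissible_AYBE_solution mul d eth s ->
  is_diff_ASI_bialgebra mul (coboundary s) d eth.
Proof.
move=> adm anti sol.
have alg := diff_algebra_algebra (admissible_diff_algebra adm).
split=> //; first split=> //.
- exact: coboundary_coassoc (AYBE_eq sol).
- by move=> a b; apply: coboundary_mul.
- by move=> a b; apply: coboundary_sym.
- by move=> k; apply/lfunP=> x; rewrite !comp_lfunE (coboundary_eth adm).
- move=> k; apply/lfunP=> x.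
  by rewrite add_lfunE !comp_lfunE (coboundary_d_l adm).
- move=> k; apply/lfunP=> x.
  by rewrite add_lfunE !comp_lfunE (coboundary_d_r adm).
Qed.

End Coboundary.

(** * Dual bases *)

Section DualBases.
Set Implicit Arguments.
Variables (F : fieldType) (A : vectType F).

Lemma transposeE (U V : vectType F) (f : 'Hom(U, V)) (g : dual V) x :
  transpose f g x = g (f x).
Proof. by rewrite lfunE comp_lfunE. Qed.

Lemma dualP (f : dual A) c a b : f (c *: a + b) = c * f a + f b :> F.
Proof. by rewrite linearP. Qed.

Lemma dualD (f : dual A) a b : f (a + b) = f a + f b :> F.
Proof. by rewrite linearD. Qed.

Lemma dualN (f : dual A) a : f (- a) = - f a :> F.
Proof. by rewrite linearN. Qed.

Variables (n : nat) (e : n.-tuple A) (estar : 'I_n -> dual A).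
Hypothesis (he : basis_of {:A} e)
  (hestar : forall i j : 'I_n, estar i (tnth e j) = (i == j)%:R).

Lemma linear_comb (U V : vectType F) (f : U -> V) (c : 'I_n -> F)
    (u : 'I_n -> U) :
  linear f -> f (\sum_i c i *: u i) = \sum_i c i *: f (u i).
Proof.
move=> lf; pose g : {linear U -> V} :=
  HB.pack f (GRing.isLinear.Build F U V *:%R _ lf).
rewrite -[f]/(g : U -> V) linear_sum; apply: eq_bigr => i _.
by rewrite linearZ.
Qed.

Lemma basis_expand a : a = \sum_i estar i a *: tnth e i.
Proof.
have ea := coord_basis he (memvf a).
rewrite {1}ea; apply: eq_bigr => i _; rewrite (tnth_nth 0); congr (_ *: _).
rewrite [in RHS]ea linear_sum (bigD1 i) //= big1 => [|j ji].
  by rewrite linearZ /= -tnth_nth hestar eqxx addr0 [RHS]mulr1.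
by rewrite linearZ /= -tnth_nth hestar eq_sym (negPf ji) [LHS]mulr0.
Qed.

Lemma dual_expand (f : dual A) : f = \sum_i f (tnth e i) *: estar i.
Proof.
apply/lfunP=> a; rewrite {1}(basis_expand a) linear_sum sum_lfunE.
by apply: eq_bigr => i _; rewrite linearZ scale_lfunE /= [LHS]mulrC.
Qed.

(** The tensor pairing a basis with its dual basis corresponds to the identity
    endomorphism, so an endomorphism may be moved from one leg to the other at
    the price of a transpose. Stating this after an arbitrary bilinear map [B]
    lets the two legs stand anywhere inside a larger tensor. *)
Lemma casimir (V : vectType F) (B : dual A -> A -> V) (T : 'End(A)) :
  (forall a, linear (B^~ a)) -> (forall f, linear (B f)) ->
  \sum_j B (transpose T (estar j)) (tnth e j) =
  \sum_j B (estar j) (T (tnth e j)).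
Proof.
move=> Bl Br.
have left j : B (transpose T (estar j)) (tnth e j) =
    \sum_k estar j (T (tnth e k)) *: B (estar k) (tnth e j).
  rewrite {1}(dual_expand (transpose T (estar j))) (linear_comb _ _ (Bl _)).
  by apply: eq_bigr => k _; rewrite transposeE.
have right k : B (estar k) (T (tnth e k)) =
    \sum_j estar j (T (tnth e k)) *: B (estar k) (tnth e j).
  by rewrite {1}(basis_expand (T (tnth e k))) (linear_comb _ _ (Br _)).
rewrite (eq_bigr _ (fun j _ => left j)) (eq_bigr _ (fun k _ => right k)).
exact: exchange_big.
Qed.

End DualBases.

Arguments casimir {F A n e estar} he hestar {V} B T _ _.

(** * The semidirect product and its differential structure *)

Section Dendriform.
Set Implicit Arguments.
Variables (F : fieldType) (A : vectType F) (m : nat).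
Variables (succ prec : A -> A -> A) (d : 'I_m -> 'End(A)).
Hypothesis hA : is_diff_dendriform succ prec d.
Let dend := diff_dendriform_dendriform hA.
Let bils := dendriform_succ dend.
Let bilp := dendriform_prec dend.
Local Notation mul := (dendriform_mul succ prec).
Local Notation mulh := (hat_mul succ prec).
Local Notation H := (hat A).

Lemma dendriform_diff_algebra : is_diff_algebra mul d.
Proof.
split; [split | exact: diff_dendriform_comm hA |].
- split=> [b c x y | a c x y]; rewrite /dendriform_mul.
    by rewrite (bilinearPl bils) (bilinearPl bilp) scalerDr addrACA.
  by rewrite (bilinearPr bils) (bilinearPr bilp) scalerDr addrACA.
- move=> a b c.
  have sD := bilinear_right bils a 1; have pD := bilinear_left bilp c 1.
  have := sD (succ b c) (prec b c); have := pD (succ a b) (prec a b).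
  rewrite !scale1r /dendriform_mul => -> ->; rewrite -(dendriform_ss dend).
  rewrite (dendriform_sp dend) (dendriform_pp dend) [prec b c + _]addrC.
  by rewrite [prec a b + _]addrC !addrA.
- move=> k a b; rewrite /dendriform_mul linearD /=.
  by rewrite (diff_dendriform_succ hA) (diff_dendriform_prec hA) addrACA.
Qed.

Let bilm := algebra_bilinear (diff_algebra_algebra dendriform_diff_algebra).

Lemma dsumE (U V : vectType F) (f : 'End(U)) (g : 'End(V)) x :
  dsum f g x = (f x.1, g x.2).
Proof. by rewrite lfunE. Qed.

Lemma hat_mul1 (x y : H) : (mulh x y).1 = mul x.1 y.1.
Proof. by []. Qed.

(** Evaluating the [A^*]-component at [z] reduces identities of the semidirect
    product to identities between [succ] and [prec] under linear forms. *)
Lemma hat_mul2 (x y : H) z :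
  (mulh x y).2 z = y.2 (prec z x.1) + x.2 (succ y.1 z).
Proof. by rewrite /= add_lfunE !transposeE (RopE bilp) (LopE bils). Qed.

Lemma hat_ext (x y : H) : x.1 = y.1 -> (forall z, x.2 z = y.2 z) -> x = y.
Proof. by case: x y => [a f] [b g] /= -> /lfunP ->. Qed.

Lemma hat_linear2 c (x y : H) z : (c *: x + y).2 z = c * x.2 z + y.2 z :> F.
Proof. by rewrite /= add_lfunE scale_lfunE. Qed.

Lemma hat_add2 (x y : H) z : (x + y).2 z = x.2 z + y.2 z :> F.
Proof. by rewrite /= add_lfunE. Qed.

(** In the [A^*]-component of [x (y w) = (x y) w], the coefficients of [w], [y] and
    [x] agree by the first, second and third dendriform axiom respectively. *)
Lemma hat_algebra : is_algebra mulh.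
Proof.
split; [split|].
- move=> b c x y; apply: hat_ext => [|z]; first exact: bilinearPl bilm _ _ _ _.
  rewrite hat_linear2 !hat_mul2 hat_linear2 /= (bilinearPr bilp) dualP; ring.
- move=> b c x y; apply: hat_ext => [|z]; first exact: bilinearPr bilm _ _ _ _.
  rewrite hat_linear2 !hat_mul2 hat_linear2 /= (bilinearPl bils) dualP; ring.
- move=> x y w; apply: hat_ext => [|z].
    exact: algebra_assoc (diff_algebra_algebra dendriform_diff_algebra) _ _ _.
  rewrite !hat_mul2 !hat_mul1 /dendriform_mul -(dendriform_sp dend).
  rewrite [succ x.1 y.1 + _]addrC [succ y.1 w.1 + _]addrC.
  by rewrite (dendriform_ss dend) (dendriform_pp dend) addrA.
Qed.

Variable theta : 'I_m -> F.

(** The two families of maps on [A ⊕ A^*] enter only through their components,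
    and are kept abstract so that their construction as linear maps is never
    unfolded. *)
Variables hat_d hat_eth : 'I_m -> 'End(H).
Hypothesis hat_d1 : forall k x, (hat_d k x).1 = d k x.1.
Hypothesis hat_d2 : forall k x z,
  (hat_d k x).2 z = - x.2 (d k z) + theta k * x.2 z :> F.
Hypothesis hat_eth1 : forall k x,
  (hat_eth k x).1 = theta k *: x.1 - d k x.1.
Hypothesis hat_eth2 : forall k x z, (hat_eth k x).2 z = x.2 (d k z) :> F.

Lemma d_comm k l a : d k (d l a) = d l (d k a).
Proof.
by have /lfunP/(_ a) := diff_dendriform_comm hA k l; rewrite !comp_lfunE.
Qed.

Lemma hat_diff_algebra : is_diff_algebra mulh hat_d.
Proof.
split; [exact: hat_algebra | |].
- move=> k l; apply/lfunP=> x; rewrite [LHS]comp_lfunE [RHS]comp_lfunE.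
  apply: hat_ext => [|z]; first by rewrite !hat_d1 d_comm.
  rewrite !hat_d2 d_comm; ring.
- move=> k x y; apply: hat_ext => [|z].
    by rewrite hat_d1 /= !hat_d1 (diff_algebra_der dendriform_diff_algebra).
  rewrite hat_d2 hat_add2 !hat_mul2 !hat_d2 !hat_d1.
  rewrite (diff_dendriform_prec hA) (diff_dendriform_succ hA) !dualD.
  ring.
Qed.

(** On [A] itself this is the Leibniz rule: the terms in [theta] cancel since
    multiplication is bilinear. On [A^*] it is the Leibniz rule for [prec] and
    [succ] under a linear form. *)
Lemma hat_admissible : is_admissible mulh hat_d hat_eth.
Proof.
have der := diff_algebra_der dendriform_diff_algebra.
have cancel (p q r : A) : q + (p - (r + q)) = p - r.
  by rewrite [r + q]addrC opprD addrCA addNKr.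
split; first exact: hat_diff_algebra.
- move=> k l; apply/lfunP=> x; rewrite [LHS]comp_lfunE [RHS]comp_lfunE.
  apply: hat_ext => [|z]; last by rewrite !hat_eth2 d_comm.
  have dB j c a b : d j (c *: a - b) = c *: d j a - d j b.
    by rewrite linearB linearZ.
  rewrite !hat_eth1 !dB !scalerBr !scalerA d_comm mulrC !opprB !addrA.
  by rewrite [LHS]addrAC [in LHS](addrAC (_ *: _)) [LHS]addrAC.
- move=> k x y; apply: hat_ext => [|z].
    rewrite /= !(hat_eth1, hat_d1) /= (bilinearPl bilm) (bilinearNl bilm) der.
    by rewrite [RHS]cancel.
  rewrite hat_add2 hat_eth2 !hat_mul2 hat_eth2 hat_d1 hat_eth1 hat_d2.
  rewrite (bilinearPr bilp) (bilinearNr bilp) dualP dualN.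
  rewrite (diff_dendriform_prec hA) (diff_dendriform_succ hA) !dualD.
  ring.
- move=> k x y; apply: hat_ext => [|z].
    rewrite /= !(hat_eth1, hat_d1) /= (bilinearPr bilm) (bilinearNr bilm) der.
    by rewrite [X in _ = _ + (_ - X)]addrC [RHS]cancel.
  rewrite hat_add2 hat_eth2 !hat_mul2 hat_eth2 hat_d1 hat_eth1 hat_d2.
  rewrite (bilinearPl bils) (bilinearNl bils) dualP dualN.
  rewrite (diff_dendriform_prec hA) (diff_dendriform_succ hA) !dualD.
  ring.
Qed.

(** * The canonical tensor *)

Variables (n : nat) (e : n.-tuple A) (estar : 'I_n -> dual A).
Hypothesis (he : basis_of {:A} e)
  (hestar : forall i j : 'I_n, estar i (tnth e j) = (i == j)%:R).
Local Notation E i := (hat_inl (tnth e i)).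
Local Notation E' i := (hat_inr (estar i)).

Lemma hat_inlP c (a b : A) : hat_inl (c *: a + b) = c *: hat_inl a + hat_inl b.
Proof. by rewrite /hat_inl; congr pair; rewrite /= scaler0 addr0. Qed.

Lemma hat_inrP c (f g : dual A) :
  hat_inr (c *: f + g) = c *: hat_inr f + hat_inr g.
Proof. by rewrite /hat_inr; congr pair; rewrite /= scaler0 addr0. Qed.

Definition canonical_tensor : tensor H H :=
  \sum_i (E i ⊗ E' i - E' i ⊗ E i).

Lemma canonical_tensor_antisymmetric : is_antisymmetric_tensor canonical_tensor.
Proof.
rewrite /is_antisymmetric_tensor [in RHS]linear_sum -sumrN.
by apply: eq_bigr => i _; rewrite linearB /= !tswap_tens opprB.
Qed.

Lemma hat_d_inl k (a : A) : hat_d k (hat_inl a) = hat_inl (d k a).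
Proof.
apply: hat_ext => [|z]; first exact: hat_d1.
by rewrite hat_d2 /= !zero_lfunE mulr0 oppr0 addr0.
Qed.

Lemma hat_d_inr k (f : dual A) :
  hat_d k (hat_inr f) = theta k *: hat_inr f - hat_inr (transpose (d k) f).
Proof.
apply: hat_ext => [|z]; first by rewrite hat_d1 /= linear0 scaler0 subr0.
by rewrite hat_d2 /= add_lfunE opp_lfunE scale_lfunE transposeE addrC.
Qed.

Lemma hat_eth_inl k (a : A) :
  hat_eth k (hat_inl a) = theta k *: hat_inl a - hat_inl (d k a).
Proof.
apply: hat_ext => [|z]; first exact: hat_eth1.
by rewrite hat_eth2 /= add_lfunE opp_lfunE scale_lfunE !zero_lfunE scaler0 subr0.
Qed.

Lemma hat_eth_inr k (f : dual A) :
  hat_eth k (hat_inr f) = hat_inr (transpose (d k) f).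
Proof.
apply: hat_ext => [|z]; first by rewrite hat_eth1 /= scaler0 linear0 subr0.
by rewrite hat_eth2 /= transposeE.
Qed.

Lemma hat_mul_inl_inl (a b : A) :
  mulh (hat_inl a) (hat_inl b) = hat_inl (succ a b) + hat_inl (prec a b).
Proof.
apply: hat_ext => [|z] //; rewrite hat_mul2 hat_add2 /= !zero_lfunE.
by [].
Qed.

Lemma hat_mul_inl_inr (a : A) (f : dual A) :
  mulh (hat_inl a) (hat_inr f) = hat_inr (transpose (Rop prec a) f).
Proof.
apply: hat_ext => [|z]; first exact: bilinear0r bilm _.
by rewrite hat_mul2 /= zero_lfunE addr0 transposeE (RopE bilp).
Qed.

Lemma hat_mul_inr_inl (f : dual A) (b : A) :
  mulh (hat_inr f) (hat_inl b) = hat_inr (transpose (Lop succ b) f).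
Proof.
apply: hat_ext => [|z]; first exact: bilinear0l bilm _.
by rewrite hat_mul2 /= zero_lfunE add0r transposeE (LopE bils).
Qed.

Lemma hat_mul_inr_inr (f g : dual A) :
  mulh (hat_inr f) (hat_inr g) = 0.
Proof.
apply: hat_ext => [|z]; first exact: bilinear0l bilm _.
rewrite hat_mul2 /= (bilinear0r bilp) (bilinear0l bils) !linear0.
by rewrite addr0 zero_lfunE.
Qed.

Lemma casimir21 (T : 'End(A)) :
  \sum_j E j ⊗ hat_inr (transpose T (estar j)) =
  \sum_j hat_inl (T (tnth e j)) ⊗ E' j.
Proof.
by apply: (casimir he hestar (fun f a => hat_inl a ⊗ hat_inr f)) => [a|f] c x y;
  rewrite (hat_inlP, hat_inrP) (tensPl, tensPr).
Qed.

Lemma casimir12 (T : 'End(A)) :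
  \sum_j hat_inr (transpose T (estar j)) ⊗ E j =
  \sum_j E' j ⊗ hat_inl (T (tnth e j)).
Proof.
by apply: (casimir he hestar (fun f a => hat_inr f ⊗ hat_inl a)) => [a|f] c x y;
  rewrite (hat_inlP, hat_inrP) (tensPl, tensPr).
Qed.

Lemma casimir13 (T : 'End(A)) (w : H) :
  \sum_j hat_inr (transpose T (estar j)) ⊗ w ⊗ E j =
  \sum_j E' j ⊗ w ⊗ hat_inl (T (tnth e j)).
Proof.
apply: (casimir he hestar (fun f a => hat_inr f ⊗ w ⊗ hat_inl a)) => [a|f] c x y.
  by rewrite hat_inrP 2!tensPl.
by rewrite hat_inlP tensPr.
Qed.

Lemma casimir31 (T : 'End(A)) (w : H) :
  \sum_j E j ⊗ w ⊗ hat_inr (transpose T (estar j)) =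
  \sum_j hat_inl (T (tnth e j)) ⊗ w ⊗ E' j.
Proof.
apply: (casimir he hestar (fun f a => hat_inl a ⊗ w ⊗ hat_inr f)) => [a|f] c x y.
  by rewrite hat_inrP tensPr.
by rewrite hat_inlP 2!tensPl.
Qed.

Lemma casimir23 (T : 'End(A)) (w : H) :
  \sum_j w ⊗ hat_inr (transpose T (estar j)) ⊗ E j =
  \sum_j w ⊗ E' j ⊗ hat_inl (T (tnth e j)).
Proof.
apply: (casimir he hestar (fun f a => w ⊗ hat_inr f ⊗ hat_inl a)) => [a|f] c x y.
  by rewrite hat_inrP tensPr tensPl.
by rewrite hat_inlP tensPr.
Qed.

Lemma casimir32 (T : 'End(A)) (w : H) :
  \sum_j w ⊗ E j ⊗ hat_inr (transpose T (estar j)) =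
  \sum_j w ⊗ hat_inl (T (tnth e j)) ⊗ E' j.
Proof.
apply: (casimir he hestar (fun f a => w ⊗ hat_inl a ⊗ hat_inr f)) => [a|f] c x y.
  by rewrite hat_inrP tensPr.
by rewrite hat_inlP tensPr tensPl.
Qed.

Lemma tmap_canonical_tensor (f g : 'End(H)) :
  tmap f g canonical_tensor =
  \sum_i f (E i) ⊗ g (E' i) - \sum_i f (E' i) ⊗ g (E i).
Proof.
rewrite [LHS]linear_sum -sumrB; apply: eq_bigr => i _.
by rewrite [LHS]linearB /= !tmap_tens.
Qed.

Lemma canonical_d_eth k :
  tmap (hat_d k) \1 canonical_tensor = tmap \1 (hat_eth k) canonical_tensor.
Proof.
rewrite !tmap_canonical_tensor; congr (_ - _).
  rewrite (eq_bigr (fun i => hat_inl (d k (tnth e i)) ⊗ E' i)).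
    by rewrite -casimir21; apply: eq_bigr => i _; rewrite hat_eth_inr id_lfunE.
  by move=> i _; rewrite hat_d_inl id_lfunE.
transitivity (theta k *: (\sum_i E' i ⊗ E i)
    - \sum_i hat_inr (transpose (d k) (estar i)) ⊗ E i).
  rewrite scaler_sumr -sumrB; apply: eq_bigr => i _.
  by rewrite hat_d_inr id_lfunE tensDl tensNl tensZl.
rewrite casimir12 scaler_sumr -sumrB; apply: eq_bigr => i _.
by rewrite hat_eth_inl id_lfunE tensDr tensNr tensZr.
Qed.

Lemma canonical_eth_d k :
  tmap (hat_eth k) \1 canonical_tensor = tmap \1 (hat_d k) canonical_tensor.
Proof.
rewrite !tmap_canonical_tensor; congr (_ - _); last first.
  rewrite (eq_bigr (fun i => hat_inr (transpose (d k) (estar i)) ⊗ E i)).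
    by rewrite casimir12; apply: eq_bigr => i _; rewrite hat_d_inl id_lfunE.
  by move=> i _; rewrite hat_eth_inr id_lfunE.
transitivity (theta k *: (\sum_i E i ⊗ E' i)
    - \sum_i hat_inl (d k (tnth e i)) ⊗ E' i).
  rewrite scaler_sumr -sumrB; apply: eq_bigr => i _.
  by rewrite hat_eth_inl id_lfunE tensDl tensNl tensZl.
rewrite -casimir21 scaler_sumr -sumrB; apply: eq_bigr => i _.
by rewrite hat_d_inr id_lfunE tensDr tensNr tensZr.
Qed.

(** The quadratic expressions of the AYBE are computed on a single sum of pure
    tensors, so the terms [e_i ⊗ e_i^*] and [- e_i^* ⊗ e_i] are indexed together
    by ['I_(n + n)], the sign being put on the left leg. *)
Definition left_leg (i : 'I_(n + n)) : H :=
  match split i with inl j => E j | inr j => - E' j end.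
Definition right_leg (i : 'I_(n + n)) : H :=
  match split i with inl j => E' j | inr j => E j end.

Lemma left_leg_l i : left_leg (lshift n i) = E i.
Proof. by rewrite /left_leg (unsplitK (inl i)). Qed.
Lemma left_leg_r i : left_leg (rshift n i) = - E' i.
Proof. by rewrite /left_leg (unsplitK (inr i)). Qed.
Lemma right_leg_l i : right_leg (lshift n i) = E' i.
Proof. by rewrite /right_leg (unsplitK (inl i)). Qed.
Lemma right_leg_r i : right_leg (rshift n i) = E i.
Proof. by rewrite /right_leg (unsplitK (inr i)). Qed.
Let legE := (left_leg_l, left_leg_r, right_leg_l, right_leg_r).

Lemma canonical_tensor_legs :
  canonical_tensor = \sum_i left_leg i ⊗ right_leg i.
Proof.
rewrite big_split_ord /canonical_tensor sumrB -sumrN.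
by congr (_ + _); apply: eq_bigr => i _; rewrite !legE ?tensNl.
Qed.

Lemma legs_sum {V : vectType F} (G : H -> H -> H -> H -> V) :
  \sum_i \sum_j G (left_leg i) (right_leg i) (left_leg j) (right_leg j) =
  \sum_i \sum_j G (E i) (E' i) (E j) (E' j) +
  \sum_i \sum_j G (E i) (E' i) (- E' j) (E j) +
  (\sum_i \sum_j G (- E' i) (E i) (E j) (E' j) +
   \sum_i \sum_j G (- E' i) (E i) (- E' j) (E j)).
Proof.
rewrite -2!big_split big_split_ord; congr (_ + _); apply: eq_bigr => i _;
by rewrite !legE big_split_ord /=; congr (_ + _); apply: eq_bigr => j _;
   rewrite !legE.
Qed.

Let bilh := algebra_bilinear hat_algebra.

(** Normal forms to which all terms of the AYBE reduce, sorted by the slot that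
    holds the product of two basis vectors. *)
Let slot1 (op : A -> A -> A) : tensor (tensor H H) H :=
  \sum_i \sum_j hat_inl (op (tnth e i) (tnth e j)) ⊗ E' i ⊗ E' j.
Let slot2 (op : A -> A -> A) : tensor (tensor H H) H :=
  \sum_i \sum_j E' i ⊗ hat_inl (op (tnth e j) (tnth e i)) ⊗ E' j.
Let slot3 (op : A -> A -> A) : tensor (tensor H H) H :=
  \sum_i \sum_j E' i ⊗ E' j ⊗ hat_inl (op (tnth e i) (tnth e j)).

(** In each of the three double sums of the AYBE, one term multiplies two basis
    vectors of [A] and gives the full product [succ + prec]. *)
Lemma s12s13_inl_inl :
  \sum_i \sum_j mulh (E i) (E j) ⊗ E' i ⊗ E' j = slot1 succ + slot1 prec.
Proof.
rewrite -big_split; apply: eq_bigr => i _; rewrite -big_split.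
by apply: eq_bigr => j _; rewrite hat_mul_inl_inl 2!tensDl.
Qed.

Lemma s23s12_inl_inl :
  \sum_i \sum_j E' j ⊗ mulh (E i) (E j) ⊗ E' i = slot2 succ + slot2 prec.
Proof.
rewrite exchange_big -big_split; apply: eq_bigr => i _; rewrite -big_split.
by apply: eq_bigr => j _; rewrite hat_mul_inl_inl tensDr tensDl.
Qed.

Lemma s13s23_inl_inl :
  \sum_i \sum_j E' i ⊗ E' j ⊗ mulh (E i) (E j) = slot3 succ + slot3 prec.
Proof.
rewrite -big_split; apply: eq_bigr => i _; rewrite -big_split.
by apply: eq_bigr => j _; rewrite hat_mul_inl_inl tensDr.
Qed.

(** The six mixed terms. A product of a basis vector with a dual basis vector is
    a dual vector transformed by [R_prec^*] or [L_succ^*]; [casimir] carries that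
    operator over to the matching basis vector, which becomes its image under
    [prec] or [succ]. *)
Lemma s12s13_mixed_prec :
  \sum_i \sum_j mulh (E i) (E' j) ⊗ E' i ⊗ E j = slot3 prec.
Proof.
rewrite /slot3 [RHS]exchange_big; apply: eq_bigr => i _.
under [LHS]eq_bigr => j _ do rewrite hat_mul_inl_inr.
by rewrite casimir13; apply: eq_bigr => j _; rewrite (RopE bilp).
Qed.

Lemma s12s13_mixed_succ :
  \sum_i \sum_j mulh (E' i) (E j) ⊗ E i ⊗ E' j = slot2 succ.
Proof.
rewrite [LHS]exchange_big /slot2 [RHS]exchange_big; apply: eq_bigr => j _.
under [LHS]eq_bigr => i _ do rewrite hat_mul_inr_inl.
rewrite -tens_suml casimir12 tens_suml.
by apply: eq_bigr => i _; rewrite (LopE bils).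
Qed.

Lemma s13s23_mixed_succ :
  \sum_i \sum_j E i ⊗ E' j ⊗ mulh (E' i) (E j) = slot1 succ.
Proof.
rewrite [LHS]exchange_big; apply: eq_bigr => j _.
under [LHS]eq_bigr => i _ do rewrite hat_mul_inr_inl.
by rewrite casimir31; apply: eq_bigr => i _; rewrite (LopE bils).
Qed.

Lemma s13s23_mixed_prec :
  \sum_i \sum_j E' i ⊗ E j ⊗ mulh (E i) (E' j) = slot2 prec.
Proof.
apply: eq_bigr => i _.
under [LHS]eq_bigr => j _ do rewrite hat_mul_inl_inr.
by rewrite casimir32; apply: eq_bigr => j _; rewrite (RopE bilp).
Qed.

Lemma s23s12_mixed_prec :
  \sum_i \sum_j E j ⊗ mulh (E i) (E' j) ⊗ E' i = slot1 prec.
Proof.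
rewrite /slot1 [RHS]exchange_big; apply: eq_bigr => i _.
under [LHS]eq_bigr => j _ do rewrite hat_mul_inl_inr.
rewrite -tens_suml casimir21 tens_suml.
by apply: eq_bigr => j _; rewrite (RopE bilp).
Qed.

Lemma s23s12_mixed_succ :
  \sum_i \sum_j E' j ⊗ mulh (E' i) (E j) ⊗ E i = slot3 succ.
Proof.
rewrite [LHS]exchange_big; apply: eq_bigr => j _.
under [LHS]eq_bigr => i _ do rewrite hat_mul_inr_inl.
by rewrite casimir23; apply: eq_bigr => i _; rewrite (LopE bils).
Qed.

Lemma sum2_opp (V : vectType F) (X Y : 'I_n -> 'I_n -> V) :
  (forall i j, X i j = - Y i j) ->
  \sum_i \sum_j X i j = - \sum_i \sum_j Y i j.
Proof.
move=> XY; rewrite -sumrN; apply: eq_bigr => i _.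
by rewrite -sumrN; apply: eq_bigr => j _.
Qed.

Lemma sum2_0 (V : vectType F) (X : 'I_n -> 'I_n -> V) :
  (forall i j, X i j = 0) -> \sum_i \sum_j X i j = 0.
Proof. by move=> X0; apply: big1 => i _; apply: big1 => j _. Qed.

Lemma canonical_s12s13 :
  s12s13 mulh canonical_tensor =
  slot1 succ + slot1 prec + - slot3 prec + (- slot2 succ + 0).
Proof.
rewrite canonical_tensor_legs (s12s13_sum bilh).
rewrite (legs_sum (fun x y z t => mulh x z ⊗ y ⊗ t)).
rewrite -s12s13_mixed_prec -s12s13_mixed_succ -s12s13_inl_inl.
congr (_ + _ + (_ + _)).
- by apply: sum2_opp => i j; rewrite (bilinearNr bilh) 2!tensNl.
- by apply: sum2_opp => i j; rewrite (bilinearNl bilh) 2!tensNl.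
- apply: sum2_0 => i j.
  by rewrite (bilinearNl bilh) (bilinearNr bilh) hat_mul_inr_inr !oppr0 2!tens0l.
Qed.

Lemma canonical_s13s23 :
  s13s23 mulh canonical_tensor =
  0 + - slot1 succ + (- slot2 prec + (slot3 succ + slot3 prec)).
Proof.
rewrite canonical_tensor_legs (s13s23_sum bilh).
rewrite (legs_sum (fun x y z t => x ⊗ z ⊗ mulh y t)).
rewrite -s13s23_mixed_succ -s13s23_mixed_prec -s13s23_inl_inl.
congr (_ + _ + (_ + _)).
- by apply: sum2_0 => i j; rewrite hat_mul_inr_inr tens0r.
- by apply: sum2_opp => i j; rewrite tensNr tensNl.
- by apply: sum2_opp => i j; rewrite 2!tensNl.
- apply: eq_bigr => i _; apply: eq_bigr => j _.
  by rewrite tensNl tensNr tensNl tensNl opprK.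
Qed.

Lemma canonical_s23s12 :
  s23s12 mulh canonical_tensor =
  slot1 prec + - (slot2 succ + slot2 prec) + (0 + slot3 succ).
Proof.
rewrite canonical_tensor_legs (s23s12_sum bilh).
rewrite (legs_sum (fun x y z t => z ⊗ mulh x t ⊗ y)).
rewrite -s23s12_mixed_prec -s23s12_mixed_succ -s23s12_inl_inl.
congr (_ + _ + (_ + _)).
- by apply: sum2_opp => i j; rewrite 2!tensNl.
- apply: sum2_0 => i j.
  by rewrite (bilinearNl bilh) hat_mul_inr_inr oppr0 tens0r tens0l.
- apply: eq_bigr => i _; apply: eq_bigr => j _.
  by rewrite (bilinearNl bilh) tensNl tensNl tensNr tensNl opprK.
Qed.

Lemma canonical_tensor_solution :
  is_admissible_AYBE_solution mulh hat_d hat_eth canonical_tensor.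
Proof.
split.
- rewrite canonical_s12s13 canonical_s13s23 canonical_s23s12.
  move: (slot1 succ) (slot1 prec) (slot2 succ) (slot2 prec)
    (slot3 succ) (slot3 prec).
  by move=> *; apply/matrixP => i j; rewrite !mxE; ring.
- by move=> k; rewrite add_lfunE opp_lfunE canonical_d_eth subrr.
- by move=> k; rewrite add_lfunE opp_lfunE canonical_eth_d subrr.
Qed.

End Dendriform.

Theorem proposition4p27 (F : fieldType) (charF0 : [pchar F] =i pred0)
    (A : vectType F) (m : nat)
    (succ prec : A -> A -> A) (d : 'I_m -> 'End(A))
    (hA : is_diff_dendriform succ prec d)
    (n : nat) (e : n.-tuple A) (he : basis_of {:A} e)
    (estar : 'I_n -> dual A)
    (hestar : forall i j : 'I_n, estar i (tnth e j) = (i == j)%:R)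
    (theta : 'I_m -> F) :
  let mulh := hat_mul succ prec in
  let Phih := fun k : 'I_m =>
    dsum (d k) (- transpose (d k) + theta k *: \1%VF) in
  let Psih := fun k : 'I_m =>
    dsum (- d k + theta k *: \1%VF) (transpose (d k)) in
  let s : tensor (hat A) (hat A) :=
    \sum_(i < n) (hat_inl (tnth e i) ⊗ hat_inr (estar i)
                  - hat_inr (estar i) ⊗ hat_inl (tnth e i)) in
  [/\ is_diff_algebra (dendriform_mul succ prec) d,
      is_admissible mulh Phih Psih,
      is_antisymmetric_tensor s,
      is_admissible_AYBE_solution mulh Phih Psih s
    & exists Delta : 'Hom(hat A, tensor (hat A) (hat A)),
        (forall x, Delta x =
           (tmap \1 (Lop mulh x) - tmap (Rop mulh x) \1)%VF s) /\
        is_diff_ASI_bialgebra mulh Delta Phih Psih].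
Proof.
move=> mulh Phih Psih s.
have Phi1 k x : (Phih k x).1 = d k x.1 by rewrite dsumE.
have Phi2 k x z : (Phih k x).2 z = - x.2 (d k z) + theta k * x.2 z :> F.
  rewrite dsumE /= !(add_lfunE, opp_lfunE, scale_lfunE) id_lfunE.
  by rewrite transposeE.
have Psi1 k x : (Psih k x).1 = theta k *: x.1 - d k x.1.
  by rewrite dsumE /= add_lfunE opp_lfunE scale_lfunE id_lfunE addrC.
have Psi2 k x z : (Psih k x).2 z = x.2 (d k z) :> F.
  by rewrite dsumE /= transposeE.
have adm : is_admissible mulh Phih Psih by apply: (hat_admissible hA).
have sol : is_admissible_AYBE_solution mulh Phih Psih s.
  by apply: (canonical_tensor_solution hA).
have anti : is_antisymmetric_tensor s by apply: canonical_tensor_antisymmetric.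
split=> //; first exact: dendriform_diff_algebra.
have bil := algebra_bilinear (diff_algebra_algebra (admissible_diff_algebra adm)).
exists (coboundary mulh s); split; last exact: coboundary_diff_ASI.
by move=> x; rewrite (coboundaryE bil) add_lfunE opp_lfunE.
Qed.
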